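(* Let $n=m=1$, and consider the problem of minimizing $P(x):=-x^2-x$ over the feasible set $\mathcal{X}_a:=\{x\in\mathbb{R}\mid q(x)\le 0\}$, where $q(x):=\tfrac12x^2+x$. This is the problem $(\mathcal{P}_{qq})$ described in the context with $A=-2$, $f=1$, $Q_1=1$, $b_1=1$, $c_1=0$. Then $G(\sigma)=\sigma-2$, $F(\sigma)=1-\sigma$, $\mathcal{S}=[0,2)\cup(2,\infty)$, $P^d(\sigma)=-\tfrac12\frac{(1-\sigma)^2}{\sigma-2}$ for $\sigma\in\mathcal{S}$, $\mathcal{X}_a=[-2,0]$, and $\mathcal{Y}=[0,1]\cup[3,\infty)$. The point $\overline{\sigma}:=0$ is the unique solution of the dual problem $\max_{\sigma\in\mathcal{Y}}P^d(\sigma)$. However, for $\overline{x}:=G(\overline{\sigma})^{-1}F(\overline{\sigma})=-\tfrac12$ one has $\tfrac14=P^d(\overline{\sigma})=P(\overline{x})>P(-2)=-2$, so $\overline{x}$ is not a solution of $(\mathcal{P}_{qq})$. In fact $P(\overline{x})>P(x)$ for every $x\in\mathbb{R}\setminus\{\overline{x}\}$. In particular, the following assertion is false: ''whenever $\mathcal{Y}\neq\emptyset$ and $\overline{\sigma}$ is a solution of $\max_{\sigma\in\mathcal{Y}}P^d(\sigma)$, the point $\overline{x}=G(\overline{\sigma})^{-1}F(\overline{\sigma})$ is a solution of $(\mathcal{P}_{qq})$ and $P(\overline{x})=P^d(\overline{\sigma})$.''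
   Context: General setting. Given a symmetric indefinite matrix $A\in\mathbb{R}^{n\times n}$ (in the example $n=1$ and $A=-2$), a vector $f\in\mathbb{R}^n$, $f\ne0$, nonsingular symmetric matrices $Q_i\in\mathbb{R}^{n\times n}$, vectors $b_i\in\mathbb{R}^n$ and reals $c_i$ ($i=1,\dots,m$), the primal problem $(\mathcal{P}_{qq})$ is to minimize $P(x)=\tfrac12x^TAx-f^Tx$ over $\mathcal{X}_a=\{x\in\mathbb{R}^n\mid \tfrac12x^TQ_ix+b_i^Tx\le c_i,\ i=1,\dots,m\}$. A solution of $(\mathcal{P}_{qq})$ is a point of $\mathcal{X}_a$ at which $P$ attains its global minimum over $\mathcal{X}_a$. For $\sigma\in\mathbb{R}^m$ put $G(\sigma)=A+\sum_{i=1}^m\sigma_iQ_i$, $F(\sigma)=f-\sum_{i=1}^m\sigma_ib_i$, $c=(c_1,\dots,c_m)^T$. Let $\mathcal{S}=\{\sigma\in\mathbb{R}^m\mid\sigma\ge0\text{ (componentwise)},\ \det G(\sigma)\ne0\}$, and for $\sigma\in\mathcal{S}$ let $P^d(\sigma)=-\tfrac12F(\sigma)^TG(\sigma)^{-1}F(\sigma)-c^T\sigma$. Let $\mathcal{Y}=\{\sigma\in\mathcal{S}\mid G(\sigma)^{-1}F(\sigma)\in\mathcal{X}_a\}$. The dual problem is $\max_{\sigma\in\mathcal{Y}}P^d(\sigma)$, and a solution of it is a point of $\mathcal{Y}$ at which $P^d$ attains its global maximum over $\mathcal{Y}$. *)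

(* Defs.v *)
From mathcomp Require Import all_boot all_order all_algebra.
From mathcomp Require Import all_classical all_reals.

Set Implicit Arguments.
Unset Strict Implicit.
Unset Printing Implicit Defensive.

Import Order.TTheory GRing.Theory Num.Theory.
Local Open Scope classical_set_scope.
Local Open Scope ring_scope.

Definition symmetric_mx (R : realType) (n : nat) (M : 'M[R]_n) : Prop :=
  M^T = M.

Definition dot (R : realType) (n : nat) (u v : 'cV[R]_n) : R :=
  (u^T *m v) 0 0.

Definition qform (R : realType) (n : nat) (M : 'M[R]_n) (x : 'cV[R]_n) : R :=
  (x^T *m M *m x) 0 0.

(* "Indefinite" is read as "not positive semidefinite" (so the objective is
   nonconvex): the case n = 1, A = -2 has to be covered, which the stricter
   convention (the form takes both signs) would exclude. *)
Definition indefinite_mx (R : realType) (n : nat) (M : 'M[R]_n) : Prop :=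
  ~ (forall x : 'cV[R]_n, 0 <= qform M x).

Definition is_global_min (R : realType) (T : Type) (D : set T) (g : T -> R)
    (x : T) : Prop :=
  D x /\ forall y, D y -> g x <= g y.

Definition is_global_max (R : realType) (T : Type) (D : set T) (g : T -> R)
    (x : T) : Prop :=
  D x /\ forall y, D y -> g y <= g x.

Record qq_problem (R : realType) (n m : nat) := QQProblem {
  qqA : 'M[R]_n;
  qqf : 'cV[R]_n;
  qqQ : 'I_m -> 'M[R]_n;
  qqb : 'I_m -> 'cV[R]_n;
  qqc : 'cV[R]_m }.

Definition qq_standing (R : realType) (n m : nat) (p : qq_problem R n m)
    : Prop :=
  [/\ symmetric_mx (qqA p), indefinite_mx (qqA p), qqf p != 0
    & forall i, symmetric_mx (qqQ p i) /\ qqQ p i \in unitmx].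

Section Problem.
Variables (R : realType) (n m : nat) (p : qq_problem R n m).

Definition primal_obj (x : 'cV[R]_n) : R :=
  2^-1 * qform (qqA p) x - dot (qqf p) x.

Definition constraint (i : 'I_m) (x : 'cV[R]_n) : R :=
  2^-1 * qform (qqQ p i) x + dot (qqb p i) x.

Definition primal_feasible : set 'cV[R]_n :=
  [set x | forall i, constraint i x <= qqc p i 0].

Definition primal_solution (x : 'cV[R]_n) : Prop :=
  is_global_min primal_feasible primal_obj x.

Definition dualG (s : 'cV[R]_m) : 'M[R]_n :=
  qqA p + \sum_(i < m) s i 0 *: qqQ p i.

Definition dualF (s : 'cV[R]_m) : 'cV[R]_n :=
  qqf p - \sum_(i < m) s i 0 *: qqb p i.

Definition dualS : set 'cV[R]_m :=
  [set s : 'cV[R]_m | (forall i, 0 <= s i 0) /\ \det (dualG s) != 0].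

(* The next two functions are meaningful on dualS only, where invmx is a
   genuine inverse; every use below is restricted to that set. *)
Definition primal_point (s : 'cV[R]_m) : 'cV[R]_n :=
  invmx (dualG s) *m dualF s.

Definition dual_obj (s : 'cV[R]_m) : R :=
  - 2^-1 * qform (invmx (dualG s)) (dualF s) - dot (qqc p) s.

Definition dualY : set 'cV[R]_m :=
  [set s | dualS s /\ primal_feasible (primal_point s)].

Definition dual_solution (s : 'cV[R]_m) : Prop :=
  is_global_max dualY dual_obj s.

Definition duality_assertion : Prop :=
  forall s : 'cV[R]_m, dualY !=set0 -> dual_solution s ->
    primal_solution (primal_point s)
    /\ primal_obj (primal_point s) = dual_obj s.

End Problem.

(* R^1 is 'cV_1, and the real s is identified with s%:M. *)
Definition example_problem (R : realType) : qq_problem R 1 1 :=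
  QQProblem (- 2)%:M 1%:M (fun=> 1%:M) (fun=> 1%:M) 0%:M.

(* Main.v *)
Require Import Defs.
From mathcomp Require Import all_boot all_order all_algebra.
From mathcomp Require Import all_classical all_reals.
From mathcomp Require Import ring lra.

Set Implicit Arguments.
Unset Strict Implicit.
Unset Printing Implicit Defensive.

Import Order.TTheory GRing.Theory Num.Theory.
Local Open Scope classical_set_scope.
Local Open Scope ring_scope.

(** Every column of height one is a scalar matrix, so each object attached to
the example is a function of one real variable; the primal point of
[s] is [(1 - s) / (s - 2)].  It lies in the feasible interval [[-2, 0]]
exactly when [s <= 1] (the quotient is then in [[-1/2, 0]]) or [s >= 3]: it is
positive on [(1, 2)], and for [s > 2] it equals [- 1 - (s - 2)^-1], which
is at least [- 2] exactly when [s - 2 >= 1].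

On the dual feasible set, [(1 - s)^2 <= (2 - s) / 2] for [s] in [[0, 1]], with
equality only at [0], while the dual objective is negative beyond [3]; so [0]
is the strict dual maximizer ([dual_value_lt]).  But the matrix [G(0) = -2] is
negative definite, so the stationary point [-1/2] that it yields is the
strict global *maximizer* of the concave primal objective ([primal_value_lt]),
as far as possible from a primal solution. *)

(** * One-dimensional matrices *)

Lemma dot_scalar (R : realType) (a b : R) :
  dot (a%:M : 'cV[R]_1) b%:M = a * b.
Proof. by rewrite /dot tr_scalar_mx -scalar_mxM mxE eqxx mulr1n. Qed.

Lemma qform_scalar (R : realType) (a x : R) :
  qform (a%:M : 'M[R]_1) x%:M = a * x ^+ 2.
Proof.
by rewrite /qform tr_scalar_mx -!scalar_mxM mxE eqxx mulr1n; ring.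
Qed.

Lemma scalar_mx_inj1 (R : realType) : injective (@scalar_mx R 1).
Proof. by move=> a b /matrixP /(_ 0 0); rewrite !mxE eqxx !mulr1n. Qed.

Lemma image_scalar_eq (R : realType) (D : set 'cV[R]_1) (E : set R) :
  (forall x, D x%:M <-> E x) -> D = [set x%:M | x in E].
Proof.
move=> DE; apply/seteqP; split=> [x Dx | _ [x /DE Dx <-] //].
by exists (x 0 0); [apply/DE; rewrite -mx11_scalar | rewrite -mx11_scalar].
Qed.

(** * Real inequalities *)

(** The constraint factors as [x (x + 2) / 2]. *)
Lemma constraint_value_le0 (R : realType) (x : R) :
  (2^-1 * x ^+ 2 + x <= 0) = (- 2 <= x <= 0).
Proof.
apply/idP/idP=> [qx | /andP[x1 x2]]; last by nra.
by apply/andP; split; nra.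
Qed.

(** Multiplying by the denominator [s - 2], whose sign depends on the branch,
makes the two bounds linear in [s]. *)
Lemma primal_point_bounds (R : realType) (s : R) : 0 <= s -> s != 2 ->
  (- 2 <= (s - 2)^-1 * (1 - s) <= 0) = (s <= 1) || (3 <= s).
Proof.
move=> s0 s2; rewrite mulrC.
have [lts|gts] : s < 2 \/ 2 < s by apply/orP; rewrite -neq_lt.
  have d0 : s - 2 < 0 by lra.
  rewrite ler_ndivlMr // ler_ndivrMr // mul0r.
  by apply/andP/orP=> [[h1 h2]|[h|h]]; [left|split|split]; lra.
have d0 : 0 < s - 2 by lra.
rewrite ler_pdivlMr // ler_pdivrMr // mul0r.
by apply/andP/orP=> [[h1 h2]|[h|h]]; [right|split|split]; lra.
Qed.

Lemma dual_value_lt (R : realType) (s : R) :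
  0 <= s -> (s <= 1) || (3 <= s) -> s != 0 ->
  - 2^-1 * ((1 - s) ^+ 2 / (s - 2)) < 4^-1.
Proof.
move=> s0 sY sn0; have sgt0 : 0 < s by rewrite lt_neqAle eq_sym sn0.
rewrite mulNr ltrNl mulrA.
case/orP: sY => hs.
  (* Here the claim reduces to s (2 s - 3) < 0. *)
  have d0 : s - 2 < 0 by lra.
  by rewrite ltr_ndivlMr //; nra.
have d0 : 0 < s - 2 by lra.
by rewrite ltr_pdivlMr //; nra.
Qed.

(** The gap is the square of [x + 1/2]. *)
Lemma primal_value_lt (R : realType) (x : R) : x != - 2^-1 ->
  - x ^+ 2 - x < 4^-1.
Proof.
rewrite -subr_eq0 => xn.
have sq_gt0 : 0 < (x - - 2^-1) ^+ 2 by rewrite exprn_even_gt0.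
by nra.
Qed.

(** * The example *)

Section Example.
Variable R : realType.
Let p := example_problem R.

Lemma primal_objE (x : R) : primal_obj p x%:M = - x ^+ 2 - x.
Proof. by rewrite /primal_obj /= qform_scalar dot_scalar; field. Qed.

Lemma constraintE (i : 'I_1) (x : R) :
  constraint p i x%:M = 2^-1 * x ^+ 2 + x.
Proof. by rewrite /constraint /= qform_scalar dot_scalar; ring. Qed.

Lemma primal_feasibleE (x : R) : primal_feasible p x%:M <-> - 2 <= x <= 0.
Proof.
rewrite -constraint_value_le0; split=> [/(_ 0) | xq i];
  by rewrite constraintE /= mxE mul0rn.
Qed.

Lemma dualGE (s : R) : dualG p s%:M = (s - 2)%:M.
Proof.
rewrite /dualG big_ord1 /= mxE eqxx mulr1n scale_scalar_mx mulr1.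
by rewrite -raddfD /= addrC.
Qed.

Lemma dualFE (s : R) : dualF p s%:M = (1 - s)%:M.
Proof.
by rewrite /dualF big_ord1 /= mxE eqxx mulr1n scale_scalar_mx mulr1 -raddfB.
Qed.

Lemma dualSE (s : R) : dualS p s%:M <-> 0 <= s /\ s != 2.
Proof.
rewrite /dualS /= dualGE det_scalar1 subr_eq0.
split=> [[s0 s2]|[s0 s2]]; split=> //.
  by have := s0 0; rewrite mxE eqxx mulr1n.
by move=> i; rewrite mxE !ord1 eqxx mulr1n.
Qed.

Lemma primal_pointE (s : R) :
  primal_point p s%:M = ((s - 2)^-1 * (1 - s))%:M.
Proof. by rewrite /primal_point dualGE dualFE invmx_scalar -scalar_mxM. Qed.

Lemma dual_objE (s : R) :
  dual_obj p s%:M = - 2^-1 * ((1 - s) ^+ 2 / (s - 2)).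
Proof.
rewrite /dual_obj dualGE dualFE invmx_scalar qform_scalar /= dot_scalar.
by rewrite mul0r subr0 [_^-1 * _ ^+ 2]mulrC.
Qed.

Lemma dualYE (s : R) :
  dualY p s%:M <-> 0 <= s /\ (s <= 1) || (3 <= s).
Proof.
rewrite /dualY /= primal_pointE dualSE primal_feasibleE.
split=> [[[s0 s2]]|[s0 sY]]; first by rewrite primal_point_bounds.
have s2 : s != 2 by apply/eqP=> s2; case/orP: sY; lra.
by rewrite primal_point_bounds.
Qed.

Lemma primal_point0 : primal_point p 0%:M = (- 2^-1)%:M.
Proof. by rewrite primal_pointE; congr (_%:M); field. Qed.

Lemma dual_obj0 : dual_obj p 0%:M = 4^-1.
Proof. by rewrite dual_objE; field. Qed.

Lemma primal_obj_half : primal_obj p (- 2^-1)%:M = 4^-1.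
Proof. by rewrite primal_objE; field. Qed.

Lemma dualY0 : dualY p 0%:M.
Proof. by apply/dualYE; rewrite lexx ler01. Qed.

Lemma dual_obj_lt (s : 'cV[R]_1) :
  dualY p s -> s != 0%:M -> dual_obj p s < dual_obj p 0%:M.
Proof.
rewrite [s]mx11_scalar (inj_eq (@scalar_mx_inj1 R)) dual_obj0 dual_objE.
by move=> /dualYE[]; exact: dual_value_lt.
Qed.

Lemma dual_solution0 : dual_solution p 0%:M.
Proof.
split=> [|s Ys]; first exact: dualY0.
by have [->//|/(dual_obj_lt Ys)/ltW] := eqVneq s 0%:M.
Qed.

Lemma dual_solution_unique (s : 'cV[R]_1) : dual_solution p s -> s = 0%:M.
Proof.
move=> [Ys s_max]; apply/eqP/negPn/negP=> /(dual_obj_lt Ys).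
by rewrite ltNge s_max //; exact: dualY0.
Qed.

Lemma primal_obj_lt (x : 'cV[R]_1) : x != (- 2^-1)%:M ->
  primal_obj p x < primal_obj p (- 2^-1)%:M.
Proof.
rewrite [x]mx11_scalar (inj_eq (@scalar_mx_inj1 R)) primal_obj_half.
by rewrite primal_objE; exact: primal_value_lt.
Qed.

Lemma primal_obj_ltN2 :
  primal_obj p (- 2)%:M < primal_obj p (- 2^-1)%:M.
Proof. by rewrite primal_obj_half primal_objE; lra. Qed.

Lemma not_primal_solution : ~ primal_solution p (- 2^-1)%:M.
Proof.
move=> [_ half_min].
have feasibleN2 : primal_feasible p (- 2)%:M.
  by apply/primal_feasibleE; rewrite lexx oppr_le0 ler0n.
by have := half_min _ feasibleN2; rewrite leNgt primal_obj_ltN2.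
Qed.

Lemma not_duality_assertion : ~ duality_assertion p.
Proof.
move=> /(_ 0%:M (ex_intro _ _ dualY0) dual_solution0)[].
by rewrite primal_point0 => /not_primal_solution.
Qed.

Lemma example_standing : qq_standing p.
Proof.
split=> [|/(_ 1%:M)||i] /=.
- exact: tr_scalar_mx.
- by rewrite /= qform_scalar; lra.
- by rewrite -subr_eq0 subr0 oner_eq0.
- by split; [exact: tr_scalar_mx | exact: unitmx1].
Qed.

End Example.

Theorem mainTheorem1 (R : realType) :
  let p := example_problem R in
  let P (x : R) : R := - x ^+ 2 - x in
  let q (x : R) : R := 2^-1 * x ^+ 2 + x in
  let sbar : 'cV[R]_1 := 0%:M in
  let xbar : 'cV[R]_1 := primal_point p sbar in
  (* the instance *)
  qq_standing p
  /\ (forall x : R, primal_obj p x%:M = P x)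
  /\ (forall (i : 'I_1) (x : R), constraint p i x%:M = q x)
  /\ primal_feasible p = [set x%:M | x in [set x : R | q x <= 0]]
  (* the explicit form of the dual data *)
  /\ (forall s : R, dualG p s%:M = (s - 2)%:M)
  /\ (forall s : R, dualF p s%:M = (1 - s)%:M)
  /\ dualS p = [set s%:M | s in [set` `[0 : R, 2[] `|` [set` `]2 : R, +oo[]]
  /\ (forall s : R, dualS p s%:M ->
        dual_obj p s%:M = - 2^-1 * ((1 - s) ^+ 2 / (s - 2)))
  /\ primal_feasible p = [set x%:M | x in [set` `[- 2 : R, 0]]]
  /\ dualY p = [set s%:M | s in [set` `[0 : R, 1]] `|` [set` `[3 : R, +oo[]]
  (* 0 is the unique dual solution *)
  /\ dual_solution p sbar
  /\ (forall s : 'cV[R]_1, dual_solution p s -> s = sbar)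
  (* the corresponding primal point is the strict global maximizer of P *)
  /\ xbar = (- 2^-1)%:M
  /\ dual_obj p sbar = 4^-1
  /\ primal_obj p xbar = dual_obj p sbar
  /\ primal_obj p (- 2)%:M = - 2
  /\ primal_obj p (- 2)%:M < primal_obj p xbar
  /\ ~ primal_solution p xbar
  /\ (forall x : 'cV[R]_1, x != xbar -> primal_obj p x < primal_obj p xbar)
  (* the duality assertion fails for this instance, hence in general *)
  /\ ~ duality_assertion p
  /\ ~ (forall (n m : nat) (p' : qq_problem R n m),
          (0 < n)%N -> (0 < m)%N -> qq_standing p' -> duality_assertion p').
Proof.
move=> p P q sbar xbar.
have xbarE : xbar = (- 2^-1)%:M by exact: primal_point0.
split; first exact: example_standing.
split; first exact: primal_objE.
split; first exact: constraintE.
split.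
  apply: image_scalar_eq => x.
  by rewrite primal_feasibleE /= /q constraint_value_le0.
split; first exact: dualGE.
split; first exact: dualFE.
split.
  apply: image_scalar_eq => s; rewrite dualSE /= !in_itv /= andbT.
  split=> [[s0]|[/andP[s0 s2]|s2]].
  - by rewrite neq_lt => /orP[s2|s2]; [left; rewrite s0 | right].
  - by rewrite lt_eqF.
  - by rewrite gt_eqF // (le_trans _ (ltW s2)).
split; first by move=> s _; exact: dual_objE.
split.
  by apply: image_scalar_eq => x; rewrite primal_feasibleE /= in_itv.
split.
  apply: image_scalar_eq => s; rewrite dualYE /= !in_itv /= andbT.
  split=> [[s0 /orP[s1|s3]]|[/andP[s0 s1]|s3]].
  - by left; rewrite s0.
  - by right.
  - by rewrite s0 s1.
  - by rewrite s3 orbT (le_trans _ s3).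
split; first exact: dual_solution0.
split; first exact: dual_solution_unique.
split=> //.
split; first exact: dual_obj0.
rewrite xbarE.
split; first by rewrite primal_obj_half dual_obj0.
split; first by rewrite primal_objE; ring.
split; first exact: primal_obj_ltN2.
split; first exact: not_primal_solution.
split; first exact: primal_obj_lt.
split; first exact: not_duality_assertion.
move=> /(_ 1%N 1%N p isT isT (example_standing R)).
exact: not_duality_assertion.
Qed.
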